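(* Let $(X,d)$ be a metric space, $\phi:X\to(-\infty,+\infty]$ a proper lower semicontinuous functional, and $\lambda\in\mathbb R$. A curve $u:(0,+\infty)\to\overline{\mathrm{Dom}(\phi)}$ is a solution of the Evolution Variational Inequality $\mathrm{EVI}_\lambda(X,d,\phi)$ if and only if it satisfies one of the following equivalent formulations. (IC1) For every $v\in\mathrm{Dom}(\phi)$ the maps $t\mapsto\phi(u_t)$ and $t\mapsto d^2(u_t,v)$ belong to $L^1_{\rm loc}((0,+\infty))$, and for all $s,t\in(0,+\infty)$ with $s<t$ $$\frac12d^2(u_t,v)-\frac12d^2(u_s,v)+\int_s^t\Big(\phi(u_r)+\frac\lambda2d^2(u_r,v)\Big)\,\mathrm dr\le(t-s)\phi(v).$$ (IC2) For every $s,t\in(0,+\infty)$ with $s<t$ and every $v\in\mathrm{Dom}(\phi)$ $$\frac{e^{\lambda(t-s)}}2d^2(u_t,v)-\frac12d^2(u_s,v)\le\mathsf E_\lambda(t-s)\big(\phi(v)-\phi(u_t)\big).$$ Furthermore, for such a curve the map $t\mapsto\phi(u_t)$ is nonincreasing (in particular it is right continuous).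
   Context: $\mathrm{Dom}(\phi):=\{x\in X:\phi(x)<+\infty\}$. For a real function $\zeta$, $\frac{\mathrm d}{\mathrm dt}^{+}\zeta(t):=\limsup_{h\downarrow0}\frac{\zeta(t+h)-\zeta(t)}h$ is the upper right Dini derivative. A solution of $\mathrm{EVI}_\lambda(X,d,\phi)$ is a continuous curve $u:t\in(0,+\infty)\mapsto u_t\in\mathrm{Dom}(\phi)$ such that $$\frac12\frac{\mathrm d}{\mathrm dt}^{+}d^2(u_t,v)+\frac\lambda2d^2(u_t,v)\le\phi(v)-\phi(u_t)\quad\text{for every }t\in(0,+\infty),\ v\in\mathrm{Dom}(\phi).$$ $\mathsf E_\lambda(t):=\int_0^te^{\lambda r}\,\mathrm dr$, i.e. $\mathsf E_\lambda(t)=\frac{e^{\lambda t}-1}\lambda$ if $\lambda\ne0$ and $\mathsf E_0(t)=t$. *)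

(* Defs.v *)
From HB Require Import structures.
From mathcomp Require Import all_boot all_order all_algebra.
From mathcomp Require Import all_classical all_reals all_analysis.
Set Implicit Arguments.
Unset Strict Implicit.
Unset Printing Implicit Defensive.
Import Order.TTheory GRing.Theory Num.Theory.
Import numFieldNormedType.Exports.
Local Open Scope classical_set_scope.
Local Open Scope ring_scope.
Local Open Scope ereal_scope.

(* Curves on (0, +oo) are total functions on R; only the values at positive
   times are ever constrained. *)

Definition Dom (X : Type) (R : realType) (phi : X -> \bar R) : set X :=
  [set x | phi x < +oo].

Definition proper_functional (X : Type) (R : realType) (phi : X -> \bar R) : Prop :=
  (forall x, -oo < phi x) /\ Dom phi !=set0.

(* Upper right Dini derivative; it may be infinite. *)
Definition dini_ur (R : realType) (zeta : R -> R) (t : R) : \bar R :=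
  limf_esup (fun h : R => ((zeta (t + h) - zeta t) / h)%:E) 0^'+.

Definition is_EVI_solution (R : realType) (X : metricType R)
    (phi : X -> \bar R) (lambda : R) (u : R -> X) : Prop :=
  [/\ forall t : R, (0 < t)%R -> Dom phi (u t),
      {within `]0%R, +oo[, continuous u} &
      forall (t : R) (v : X), (0 < t)%R -> Dom phi v ->
        2^-1%:E * dini_ur (fun r => mdist (u r) v ^+ 2)%R t
          + (lambda / 2 * mdist (u t) v ^+ 2)%:E
        <= phi v - phi (u t)].

(* Integrability refers to Lebesgue (not merely Borel) measurable functions,
   hence the completed measure. *)
Definition L1loc (R : realType) (D : set R) (f : R -> \bar R) : Prop :=
  forall K : set R, K `<=` D -> compact K ->
    (@completed_lebesgue_measure R).-integrable K f.

Definition E_lambda (R : realType) (lambda t : R) : R :=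
  (\int[@lebesgue_measure R]_(r in `[0%R, t]) expR (lambda * r))%R.

Definition IC1 (R : realType) (X : metricType R)
    (phi : X -> \bar R) (lambda : R) (u : R -> X) : Prop :=
  forall v : X, Dom phi v ->
    [/\ L1loc `]0%R, +oo[ (fun r => phi (u r)),
        L1loc `]0%R, +oo[ (fun r => (mdist (u r) v ^+ 2)%:E) &
        forall s t : R, (0 < s)%R -> (s < t)%R ->
          (2^-1 * mdist (u t) v ^+ 2 - 2^-1 * mdist (u s) v ^+ 2)%:E
            + \int[@completed_lebesgue_measure R]_(r in `[s, t])
                (phi (u r) + (lambda / 2 * mdist (u r) v ^+ 2)%:E)
          <= (t - s)%:E * phi v].

(* Here phi (u t) is not assumed finite: if it is +oo, the right-hand side of
   the inequality is -oo and the inequality fails. *)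
Definition IC2 (R : realType) (X : metricType R)
    (phi : X -> \bar R) (lambda : R) (u : R -> X) : Prop :=
  forall (s t : R) (v : X), (0 < s)%R -> (s < t)%R -> Dom phi v ->
    (expR (lambda * (t - s)) / 2 * mdist (u t) v ^+ 2
       - 2^-1 * mdist (u s) v ^+ 2)%:E
    <= (E_lambda lambda (t - s))%:E * (phi v - phi (u t)).

(* Main.v *)
(* Write F(t) = phi(u_t) and D_v(t) = d(u_t, v)^2 / 2.  A curve solving the EVI,
   or satisfying (IC1), has nonincreasing energy F: if F(s) < F(t) with s < t,
   let m be the last time in [s, t] with F(m) <= F(s); testing with v = u_m on
   [m, t], where F >= F(m), a Gronwall argument gives D_v = 0 just after m, so
   the curve stays at u_m, which is absurd.  The time m exists because phi is
   lower semicontinuous and u is continuous; under (IC1) the only continuity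
   available a priori is u_x -> u_r for x increasing to r with F(x) bounded
   above, which follows from (IC1) with v = u_x and the absolute continuity of
   the integral.  For (IC2) it suffices to test with v = u_s.  Once F is known to
   be nonincreasing, F(r) is bounded below by F(t) for r <= t, and all formulations are compared through the upper right
   derivative of D_v, without differentiating any Lebesgue integral. *)
Require Import Defs.
From HB Require Import structures.
From mathcomp Require Import all_boot all_order all_algebra.
From mathcomp Require Import ring lra.
From mathcomp Require Import all_classical all_reals all_analysis measurable_realfun.
Import Order.TTheory GRing.Theory Num.Theory.
Import numFieldNormedType.Exports.
Local Open Scope classical_set_scope.
Local Open Scope ring_scope.

(** * Dini derivatives and the function E_lambda *)

Section real_functions.
Context {R : realType}.
Implicit Types (s t r e h c lambda : R) (f g G : R -> R).

Lemma nbhs_right_ex (P : R -> Prop) t e : 0 < e ->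
  (\forall x \near t^'+, P x) -> exists2 x, t < x < t + e & P x.
Proof.
move=> e0 Pt; near t^'+ => x; exists x; last by near: x.
apply/andP; split; near: x; first exact: nbhs_right_gt.
by apply: nbhs_right_lt; rewrite ltrDl.
Unshelve. all: by end_near. Qed.

(** The witness is the supremum of the times in $[s,t]$ where [P] holds. If it is not attained, such
    times approach it from below, so closedness is asked only for limits from the left. *)
Lemma last_point (P : R -> Prop) s t : s <= t -> P s ->
  (forall r, s < r <= t ->
    (forall e, 0 < e -> exists2 x, s <= x < r & r - e < x /\ P x) -> P r) ->
  exists m, [/\ s <= m <= t, P m & forall r, m < r <= t -> ~ P r].
Proof.
move=> st Ps clP; pose S := [set x | s <= x <= t /\ P x].
have Ss : S s by split; rewrite ?lexx.
have ubS : ubound S t by move=> x [/andP[]].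
have supS : has_sup S by split; [exists s | exists t].
have sm : s <= sup S by apply: ub_le_sup => //; exists t.
have mt : sup S <= t by apply: ge_sup => //; exists s.
exists (sup S); split; first by rewrite sm.
- have [[]//|nSm] := pselect (S (sup S)).
  have [Em|nEm] := eqVneq s (sup S); first by rewrite -Em.
  apply: clP => [|e e0]; first by rewrite lt_neqAle nEm sm mt.
  have [x Sx xe] := sup_adherent e0 supS.
  have [/andP[sx xt] Px] := Sx.
  exists x; last by split.
  rewrite sx/= lt_neqAle; apply/andP; split.
    by apply/eqP => E; apply: nSm; rewrite -E.
  by apply: ub_le_sup => //; exists t.
- move=> r /andP[mr rt] Pr; have := mr; rewrite ltNge => /negP; apply.
  have Sr : S r by split => //; rewrite rt andbT (le_trans sm)// ltW.
  by apply: ub_le_sup => //; exists t.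
Qed.

Lemma near_right_shift (P : R -> Prop) t :
  (\forall h \near 0^'+, P (t + h)) -> \forall x \near t^'+, P x.
Proof.
move=> [e /= e0 he]; exists e => //= x /=.
rewrite /ball/= => xe tx; rewrite -(subrKC t x); apply: he.
  by rewrite /ball_/= sub0r opprB.
by rewrite /= subr_gt0.
Qed.

Lemma near_shift_right (P : R -> Prop) t :
  (\forall x \near t, P x) -> \forall h \near 0^'+, P (t + h).
Proof.
move=> [d /= d0 dP]; exists d => //= h /=.
rewrite /ball_/= sub0r normrN => hd h0; apply: dP.
by rewrite /ball_/= opprD addNKr normrN.
Qed.

Lemma cvg_shift_right (T : topologicalType) (f : R -> T) t (l : T) :
  f x @[x --> t] --> l -> f (t + h) @[h --> 0^'+] --> l.
Proof. by move=> fl U /fl; exact: near_shift_right. Qed.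

(** For each slope $d>0$, consider the last time at which $G(r)\le G(s)+d(r-s)$. The left condition
    makes this time exist, and the right condition moves past it unless it is $t$. Then $d$ tends to
    $0$. *)
Lemma nonincreasing_of_dini G s t : s <= t ->
  (forall r e, s < r <= t -> 0 < e -> \forall x \near r^'-, G r <= G x + e) ->
  (forall r e, s <= r < t -> 0 < e ->
     \forall h \near 0^'+, G (r + h) <= G r + e * h) ->
  G t <= G s.
Proof.
move=> st Gl Gr; apply/ler_addgt0Pr => e e0.
(* The [+ 1] keeps the denominator positive when $s=t$. *)
have [d d0 de] : exists2 d, 0 < d & d * (t - s) <= e.
  exists (e / (t - s + 1)); first by rewrite divr_gt0// ltr_wpDl// subr_ge0.
  rewrite mulrAC ler_pdivrMr; last by rewrite ltr_wpDl// subr_ge0.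
  by rewrite ler_pM2l// lerDl.
pose P r := G r <= G s + d * (r - s).
suff : P t by move=> /le_trans; apply; rewrite lerD2l.
have Ps : P s by rewrite /P subrr mulr0 addr0.
have [r rs clP|m [/andP[sm mt] Pm nP]] := last_point P s t st Ps.
  apply/ler_addgt0Pr => b b0.
  have [a /= a0 ha] := Gl r b rs b0.
  have [x /andP[sx xr] [rax Px]] := clP _ a0.
  have /= := ha x _ xr.
  rewrite gtr0_norm ?subr_gt0// ltrBlDr addrC -ltrBlDr => /(_ rax).
  move=> /le_trans; apply; rewrite lerD2r (le_trans Px)// lerD2l.
  by rewrite ler_pM2l// lerD2r ltW.
have [<-//|mNt] := eqVneq m t.
have {mNt mt}mt : m < t by rewrite lt_neqAle mNt.
have := Gr m d; rewrite sm mt d0 => /(_ erefl erefl) H.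
have {}H : \forall h \near 0^'+, G (m + h) <= G m + d * (m + h - m).
  by apply: filterS H => h; rewrite addrAC subrr add0r.
have [x /andP[mx xt] Gx] :=
  nbhs_right_ex _ _ (t - m) (ltac:(by rewrite subr_gt0))
    (near_right_shift (fun x => G x <= G m + d * (x - m)) m H).
exfalso; apply: (nP x); first by rewrite mx/= ltW// -(subrKC m t).
move: Pm; rewrite /P => Pm; rewrite (le_trans Gx)//.
by move: Pm; rewrite !mulrBr; lra.
Qed.

(* It differs from [E_lambda lambda t] for [t < 0], where the set `[0, t] is empty. *)
Definition exp_integral lambda t : R :=
  if lambda == 0 then t else (expR (lambda * t) - 1) / lambda.

(** Allows $e^{\lambda h}$ to be written as $1+\lambda\mathsf E_\lambda(h)$, so that later estimates
    need no case distinction on $\lambda=0$. *)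
Lemma exp_integralM lambda t :
  lambda * exp_integral lambda t = expR (lambda * t) - 1.
Proof.
rewrite /exp_integral; have [->|l0] := eqVneq lambda 0.
  by rewrite !mul0r expR0 subrr.
by rewrite mulrCA divff ?mulr1.
Qed.

Lemma exp_integral0 lambda : exp_integral lambda 0 = 0.
Proof. by rewrite /exp_integral mulr0 expR0 subrr mul0r if_same. Qed.

Lemma exp_integralD lambda t h : exp_integral lambda (t + h) =
  exp_integral lambda t + expR (lambda * t) * exp_integral lambda h.
Proof.
rewrite /exp_integral; have [->|l0] := eqVneq lambda 0.
  by rewrite mul0r expR0 mul1r.
by rewrite mulrDr expRD; field.
Qed.

Lemma is_derive_exp_integral lambda t :
  is_derive t 1 (exp_integral lambda) (expR (lambda * t)).
Proof.
rewrite /exp_integral; have [->|l0] := eqVneq lambda 0.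
  by rewrite mul0r expR0; exact: is_derive_id.
apply: is_derive_eq.
by rewrite /GRing.scale/=; field.
Qed.

Lemma exp_integral_gt0 lambda h : 0 < h -> 0 < exp_integral lambda h.
Proof.
move=> h0; rewrite /exp_integral; case: (ltrgt0P lambda) => [l0|l0|_] //=.
- by rewrite divr_gt0// subr_gt0 expR_gt1 mulr_gt0.
- by rewrite ltr_ndivlMr// mul0r subr_lt0 expR_lt1 nmulr_rlt0.
Qed.

Lemma E_lambdaE lambda t : 0 <= t -> E_lambda lambda t = exp_integral lambda t.
Proof.
rewrite le_eqVlt => /predU1P[<-|t0].
  by rewrite /E_lambda set_itv1 Rintegral_set1 exp_integral0.
rewrite /E_lambda /Rintegral.
have cE x : {for x, continuous (exp_integral lambda)}.
  by apply: differentiable_continuous; apply/derivable1_diffP; case: (is_derive_exp_integral lambda x).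
rewrite (continuous_FTC2 (F := exp_integral lambda) t0).
- by rewrite exp_integral0 sube0.
- apply: continuous_subspaceT => x; apply: continuous_comp; last exact: continuous_expR.
  exact: mulrl_continuous.
- split.
  + by move=> x _; case: (is_derive_exp_integral lambda x).
  + exact: cvg_at_right_filter (cE 0).
  + exact: cvg_at_left_filter (cE t).
- by move=> x _; rewrite derive1E; apply: derive_val; exact: is_derive_exp_integral.
Qed.

Lemma cvg_exp_integral_slope lambda :
  exp_integral lambda h / h @[h --> 0^'+] --> (1 : R).
Proof.
have dE := is_derive_exp_integral lambda 0.
have := @ex_derive _ _ _ _ _ _ _ dE.
rewrite /derivable => /cvg_ex[/= l El].
have l1 : l = 1.
  by rewrite -(cvg_lim _ El)//; have := @derive_val _ _ _ _ _ _ _ dE; rewrite mulr0 expR0.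
rewrite -l1; apply: cvg_trans (cvg_dnbhs_at_right El).
apply: near_eq_cvg; near=> h.
by rewrite /GRing.scale/= mulr1 addr0 exp_integral0 subr0 mulrC.
Unshelve. all: by end_near. Qed.

Lemma cvg_exp_integral0 lambda : exp_integral lambda h @[h --> 0^'+] --> (0 : R).
Proof.
rewrite -[X in _ --> X](exp_integral0 lambda).
apply: cvg_at_right_filter; apply: differentiable_continuous.
by apply/derivable1_diffP; case: (is_derive_exp_integral lambda 0).
Qed.

(** A limsup is at most $a$ when the quotients are eventually below every $a+e$; clearing the
    denominator $h>0$ leaves an inequality between reals, even though the Dini derivative may be
    infinite. *)
Lemma dini_ur_leP f t (a : R) : (dini_ur f t <= a%:E)%E <->
  forall e, 0 < e -> \forall h \near 0^'+, f (t + h) - f t <= h * (a + e).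
Proof.
split=> [fa e e0|fa].
- have : (dini_ur f t < (a + e)%:E)%E by rewrite (le_lt_trans fa)// lte_fin ltrDl.
  rewrite /dini_ur limf_esupE => /ereal_inf_lt[_ [V V0 <-] Va].
  near=> h; have h0 : 0 < h by near: h; exact: nbhs_right_gt.
  rewrite mulrC -ler_pdivrMr// -lee_fin (le_trans _ (ltW Va))//.
  by apply: ereal_sup_ubound; exists h => //; near: h.
- apply/lee_addgt0Pr => e e0; rewrite /dini_ur limf_esupE -EFinD.
  (* The limsup is an infimum of suprema over neighbourhoods; the neighbourhood taken is the set of
     positive $h$ at which the bound holds. *)
  apply: ereal_inf_le; exists (ereal_sup ((fun h : R => ((f (t + h) - f t) / h)%:E) @`
    [set h | 0 < h /\ f (t + h) - f t <= h * (a + e)])).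
    exists [set h | 0 < h /\ f (t + h) - f t <= h * (a + e)] => //.
    near=> h; split; near: h; [exact: nbhs_right_gt | exact: fa].
  apply: ge_ereal_sup => _ [h [h0 fh] <-].
  by rewrite lee_fin ler_pdivrMr// mulrC.
Unshelve. all: by end_near. Qed.

Lemma half_dini_ur_leP f t (b c : R) :
  (2^-1%:E * dini_ur f t + b%:E <= c%:E)%E <->
  forall e, 0 < e ->
    \forall h \near 0^'+, 2^-1 * f (t + h) - 2^-1 * f t <= h * (c - b + e).
Proof.
have -> : (2^-1%:E * dini_ur f t + b%:E <= c%:E)%E =
    (dini_ur f t <= (2 * (c - b))%:E)%E.
  by rewrite -leeBrDr// -EFinB lee_pdivrMl// EFinM.
split=> [/dini_ur_leP fcb e e0|fcb].
- have e20 : 0 < 2 * e by rewrite mulr_gt0.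
  by apply: filterS (fcb _ e20) => h; nra.
- apply/dini_ur_leP => e e0; have e20 : 0 < e / 2 by rewrite divr_gt0.
  by apply: filterS (fcb _ e20) => h; nra.
Qed.

End real_functions.

(** * Integrals for the completed Lebesgue measure *)

Section completed_lebesgue.
Context {R : realType}.
Implicit Types (s t r c : R).
Local Notation cmu := (@completed_lebesgue_measure R).
Local Notation completedR := (caratheodory_type (wlength (@idfun R))^*%mu).

Lemma measurable_completed (A : set R) :
  measurable (A : set (measurableTypeR R)) -> measurable (A : set completedR).
Proof. exact: sub_caratheodory. Qed.

Lemma measurable_itv_completed (i : interval R) :
  measurable ([set` i] : set completedR).
Proof. by apply: measurable_completed; exact: measurable_itv. Qed.

Lemma measurable_fun_completed (A : set R) (f : R -> R) :
  measurable (A : set (measurableTypeR R)) ->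
  measurable_fun (A : set (measurableTypeR R)) f ->
  measurable_fun (A : set completedR) f.
Proof. by move=> mA mf _ B mB; apply: measurable_completed; exact: mf. Qed.

Lemma completed_measure_itv b s t : s <= t ->
  cmu [set` Interval (BSide b s) (BRight t)] = (t - s)%:E.
Proof.
move=> st.
(* Both measures are the same outer measure, considered on different sigma-algebras, so their values
   agree by conversion. *)
transitivity (lebesgue_measure [set` Interval (BSide b s) (BRight t)]); first by [].
rewrite lebesgue_measure_itv/= lte_fin.
by case: ltgtP st => // -> _; rewrite subrr.
Qed.

Lemma completed_integral_cst b s t c : s <= t ->
  (\int[cmu]_(x in [set` Interval (BSide b s) (BRight t)]) cst c%:E x
    = (c * (t - s))%:E)%E.
Proof.
move=> st; rewrite integral_cst; last exact: measurable_itv_completed.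
by rewrite EFinM; congr (_ * _)%E; exact: completed_measure_itv.
Qed.

Lemma completed_integrable_cst b s t c : s <= t ->
  cmu.-integrable [set` Interval (BSide b s) (BRight t)] (cst c%:E).
Proof.
move=> st; apply/integrableP; split; first exact: measurable_cst.
by rewrite (eq_integral (cst `|c|%:E))// completed_integral_cst// ltry.
Qed.

Lemma completed_integral_ge b s t c (f : R -> \bar R) : s <= t ->
  cmu.-integrable [set` Interval (BSide b s) (BRight t)] f ->
  (forall x, s <= x <= t -> (c%:E <= f x)%E) ->
  ((c * (t - s))%:E <=
    \int[cmu]_(x in [set` Interval (BSide b s) (BRight t)]) f x)%E.
Proof.
move=> st intf cf; rewrite -(completed_integral_cst b)//.
apply: le_integral => //; first exact: measurable_itv_completed.
  exact: completed_integrable_cst.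
move=> x; rewrite inE /= in_itv/= => /andP[sx xt]; apply: cf.
by rewrite xt andbT; case: b sx {intf} => // /ltW.
Qed.

Lemma completed_integral_le b s t c (f : R -> \bar R) : s <= t ->
  cmu.-integrable [set` Interval (BSide b s) (BRight t)] f ->
  (forall x, s <= x <= t -> (f x <= c%:E)%E) ->
  (\int[cmu]_(x in [set` Interval (BSide b s) (BRight t)]) f x <=
    (c * (t - s))%:E)%E.
Proof.
move=> st intf cf; rewrite -(completed_integral_cst b)//.
apply: le_integral => //; first exact: measurable_itv_completed.
  exact: completed_integrable_cst.
move=> x; rewrite inE /= in_itv/= => /andP[sx xt]; apply: cf.
by rewrite xt andbT; case: b sx {intf} => // /ltW.
Qed.

Lemma completed_integrable_bounded (K : set R) (f : R -> R) c :
  compact K -> measurable_fun (K : set completedR) f ->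
  (forall x, K x -> `|f x| <= c) ->
  cmu.-integrable K (EFin \o f).
Proof.
move=> cK mf fc; apply: measurable_bounded_integrable => //.
- by apply: measurable_completed; exact: compact_measurable.
- exact: (@compact_finite_measure R).
- exists c; split; first exact: num_real.
  by move=> x cx y /= Ky; rewrite (le_trans (fc _ Ky))// ltW.
Qed.

(** A lower bound on the integral involves only the negative part of [f], which is finite everywhere
    because $f>-\infty$; absolute continuity of its integral gives [d]. This controls the energy
    integral while no pointwise lower bound on the energy is known. *)
Lemma completed_integral_absc a b (f : R -> \bar R) e :
  (forall x, -oo < f x)%E -> cmu.-integrable `[a, b] f -> 0 < e ->
  exists2 d, 0 < d & forall s t, a <= s -> s <= t -> t <= b -> t - s < d ->
    ((- e)%:E <= \int[cmu]_(x in `[s, t]) f x)%E.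
Proof.
move=> fNy intf e0.
have mab := measurable_itv_completed `[a, b].
(* The negative part, made real-valued and extended by $0$ outside $[a,b]$, is integrable on the
   whole line. *)
pose g : completedR -> R := fun x => fine ((f^\- \_ `[a, b])%E x).
have fnfin x : f^\-%E x \is a fin_num.
  rewrite funenegE; case: (f x) (fNy x) => [r _|_|]//=.
    by rewrite -EFin_max.
  by rewrite max_r// leNye.
have gE : EFin \o g = (f^\- \_ `[a, b])%E.
  apply/funext => x /=; rewrite /g patchE; case: ifPn => // _.
  by rewrite fineK.
have intg : cmu.-integrable setT (EFin \o g).
  by rewrite gE; apply/(integrable_mkcond _ mab); exact: (integrable_funeneg mab intf).
have [d [d0 dP]] := integral_normr_continuous intg e0.
exists d => // s t as_ st tb tsd.
have mst := measurable_itv_completed `[s, t].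
have std : (cmu `[s, t] < d%:E)%E by rewrite completed_measure_itv.
have stab : `[s, t] `<=` `[a, b].
  move=> x/=; rewrite !in_itv/= => /andP[sx xt].
  by rewrite (le_trans as_ sx) (le_trans xt tb).
have intfst := integrableS mab mst stab intf.
have intgst : cmu.-integrable `[s, t] (abse \o (EFin \o g)).
  by apply: integrable_abse; exact: integrableS intg.
have fing := integrable_fin_num mst intgst.
have := dP _ mst std; rewrite /Rintegral -lte_fin fineK//= => ge.
(* On $[s,t]$ the sum of the two integrands is $f+f^-=f^+\ge0$. *)
have fg0 : (0 <= \int[cmu]_(x in `[s, t]) f x + \int[cmu]_(x in `[s, t]) `|(g x)%:E|)%E.
  rewrite -integralD//; apply: integral_ge0 => x xst.
  have -> : (g x)%:E = f^\-%E x.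
    by have /(congr1 (fun h => h x)) /= -> := gE; rewrite patchE mem_set//; exact: stab.
  rewrite gee0_abs ?funeneg_ge0// funenegE; case: (f x) (fNy x) => [r _|_|]//=.
    by rewrite -EFin_max -EFinD lee_fin -lerBlDl sub0r le_max lexx.
  by rewrite max_r ?leNye// adde0 leey.
have : (0 <= \int[cmu]_(x in `[s, t]) f x + e%:E)%E.
  by apply: le_trans fg0 _; rewrite leeD2l// ltW.
by rewrite -leeBlDr// sub0e.
Qed.

End completed_lebesgue.

(** * Local integrability on the open half-line *)

Section local_integrability.
Context {R : realType}.
Implicit Types (a b : R).
Local Notation cmu := (@completed_lebesgue_measure R).

(** The complement of [K] is an open neighbourhood of $0$, which keeps [K] away from $0$;
    boundedness gives the other end. *)
Lemma compact_pos_itv (K : set R) : compact K -> K `<=` `]0, +oo[ ->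
  exists a b, 0 < a /\ K `<=` `[a, b].
Proof.
move=> cK K0; have oC : open (~` K).
  by apply: closed_openC; apply: compact_closed => //; exact: Rhausdorff.
have nK0 : (~` K) 0 by move=> /K0; rewrite /= in_itv/= ltxx.
have [d /= d0 dK] : nbhs_ball (0 : R) (~` K) by apply/nbhs_ballP; exact: open_nbhs_nbhs.
have [M [_ KM]] := compact_bounded cK.
exists d, (M + 1); split => // x Kx.
have := K0 _ Kx; rewrite /= !in_itv/= andbT => x0.
have := KM (M + 1) (ltac:(by rewrite ltrDl)) _ Kx; rewrite /= gtr0_norm// => ->.
rewrite andbT leNgt; apply/negP => xd; apply: (dK x) => //.
by rewrite /ball/= sub0r normrN gtr0_norm.
Qed.

Lemma L1loc_pos (g : R -> \bar R) (f : R -> R) :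
  (forall x, 0 < x -> g x = (f x)%:E) ->
  (forall a b, 0 < a -> measurable_fun `[a, b] f) ->
  (forall a b, 0 < a -> exists c, forall x, a <= x <= b -> `|f x| <= c) ->
  L1loc `]0, +oo[ g.
Proof.
move=> gf mf bf K K0 cK.
have [a [b [a0 Kab]]] := compact_pos_itv K cK K0.
have mK : measurable (K : set (measurableTypeR R)) by exact: compact_measurable.
have [c fc] := bf a b a0.
apply: (eq_integrable (measurable_completed _ mK) (EFin \o f)).
- by move=> x /set_mem /K0; rewrite /= in_itv/= andbT => x0; rewrite /= gf.
- apply: (completed_integrable_bounded K f c) => //.
  + apply: measurable_fun_completed => //; apply: measurable_funS (mf a b a0) => //.
  + by move=> x /Kab; rewrite /= in_itv/=; exact: fc.
Qed.

Lemma measurable_nonincreasing_pos (f : R -> R) a b :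
  (forall x y, a <= x -> x <= y -> f y <= f x) -> measurable_fun `[a, b] f.
Proof.
(* Freezing [f] at its value in $a$ on the left of $a$ makes it nonincreasing on the whole line
   without changing it on $[a,b]$. *)
move=> nf; apply: (eq_measurable_fun (fun x => f (Num.max a x))).
  by move=> x; rewrite inE/= in_itv/= => /andP[ax _]; rewrite max_r.
apply: nonincreasing_measurable => // x y xy.
apply: nf; first by rewrite le_max lexx.
by rewrite ge_max !le_max lexx xy orbT.
Qed.

Lemma measurable_continuous_itv (f : R -> R) a b :
  (forall x, a <= x <= b -> {for x, continuous f}) ->
  measurable_fun `[a, b] f.
Proof.
move=> cf; apply: subspace_continuous_measurable_fun => //.
by apply: continuous_in_subspaceT => x; rewrite inE/= in_itv/=; exact: cf.
Qed.

Lemma bounded_continuous_itv (f : R -> R) a b :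
  (forall x, a <= x <= b -> {for x, continuous f}) ->
  exists c, forall x, a <= x <= b -> `|f x| <= c.
Proof.
move=> cf.
have /compact_bounded[M [_ fM]] : compact (f @` `[a, b]).
  apply: continuous_compact; last exact: segment_compact.
  by apply: continuous_in_subspaceT => x; rewrite inE/= in_itv/=; exact: cf.
exists (M + 1) => x xab; apply: (fM (M + 1)); first by rewrite ltrDl.
by exists x => //; rewrite /= in_itv.
Qed.

Lemma L1loc_itv (g : R -> \bar R) a b : L1loc `]0, +oo[ g -> 0 < a ->
  cmu.-integrable `[a, b] g.
Proof.
move=> gL a0; apply: gL; last exact: segment_compact.
by move=> x /=; rewrite !in_itv/= andbT => /andP[/(lt_le_trans a0)].
Qed.

End local_integrability.

(** * EVI and (IC2) *)

Section metric_curves.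
Context {R : realType} {X : metricType R}.
Implicit Types (u : R -> X) (v x y : X) (t s e : R).

Definition half_sqdist u v t : R := 2^-1 * mdist (u t) v ^+ 2.

Lemma half_sqdist_ge0 u v t : 0 <= half_sqdist u v t.
Proof. by rewrite mulr_ge0// sqr_ge0. Qed.

Lemma half_sqdistxx u t : half_sqdist u (u t) t = 0.
Proof. by rewrite /half_sqdist mdistxx expr0n mulr0. Qed.

Lemma half_sqdist_lt u s t e : 0 < e ->
  half_sqdist u (u s) t < 2^-1 * e ^+ 2 -> mdist (u t) (u s) < e.
Proof.
move=> e0; rewrite ltr_pM2l ?invr_gt0// ltr_pXn2r// nnegrE ?mdist_ge0//.
exact: ltW.
Qed.

Lemma half_sqdist_le0 u s t : half_sqdist u (u s) t <= 0 -> u t = u s.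
Proof.
rewrite pmulr_rle0 ?invr_gt0// => d0; apply: mdist_positivity.
by apply/eqP; rewrite -[_ == _]sqrf_eq0 eq_le d0 sqr_ge0.
Qed.

Lemma cvg_mdistP {T} (F : set_system T) {FF : Filter F} (f : T -> X) y :
  f x @[x --> F] --> y <->
  forall e, 0 < e -> \forall x \near F, mdist y (f x) < e.
Proof.
split=> [/cvg_ball fy e e0|fy].
  by have := fy e e0; rewrite ballEmdist.
by apply/cvg_ballP => e e0; rewrite ballEmdist; exact: fy.
Qed.

Lemma ler_dist_mdist x y v : `|mdist x v - mdist y v| <= mdist x y.
Proof.
have := metric_triangle x y v; have := metric_triangle y x v.
by rewrite (metric_sym y x) ler_norml; lra.
Qed.

Lemma cvg_half_sqdist (F : set_system R) {FF : Filter F} u v y :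
  u x @[x --> F] --> y ->
  half_sqdist u v x @[x --> F] --> 2^-1 * mdist y v ^+ 2.
Proof.
move=> /cvg_mdistP uy; apply: cvgMr; rewrite expr2.
suff H : mdist (u x) v @[x --> F] --> mdist y v by exact: cvgM.
apply/cvgrPdist_lt => e e0; apply: filterS (uy _ e0) => x.
by apply: le_lt_trans; exact: ler_dist_mdist.
Qed.

Lemma lower_semicontinuous_mdist (phi : X -> \bar R) x (a : R) :
  lower_semicontinuous phi -> (a%:E < phi x)%E ->
  exists2 d, 0 < d & forall y, mdist x y < d -> (a%:E < phi y)%E.
Proof.
move=> lsc ax; have [V /nbhs_ballP[d /= d0 dV] aV] := lsc _ _ ax.
by exists d => // y xy; apply: aV; apply: dV; rewrite ballEmdist.
Qed.

(** The estimate compares an earlier with a later time, so by symmetry of the distance it serves on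
    both sides of $t$. The modulus [w] will be $\mathsf E_\lambda$ for (IC2) and the identity for
    (IC1). *)
Lemma continuous_of_modulus u (w : R -> R) : w h @[h --> 0^'+] --> 0 ->
  (forall a b, 0 < a -> a < b -> exists C, forall s t,
    a <= s -> s < t -> t <= b -> half_sqdist u (u s) t <= C * w (t - s)) ->
  forall t, 0 < t -> u r @[r --> t] --> u t.
Proof.
move=> w0 uw t t0; apply/cvg_mdistP => e e0.
(* Any interval around $t$ with positive left end would do. *)
have [||C CP] := uw (t / 2) (t + 1); [by rewrite divr_gt0| by lra|].
have : C * w h @[h --> 0^'+] --> C * 0 by exact: cvgMr.
have e20 : 0 < 2^-1 * e ^+ 2 by rewrite mulr_gt0// exprn_gt0.
rewrite mulr0 => /cvgrPdist_lt/(_ _ e20)[d /= d0 dP].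
have {}dP h : 0 < h -> h < d -> C * w h < 2^-1 * e ^+ 2.
  move=> h0 hd; have := dP h; rewrite /ball_/= !sub0r !normrN gtr0_norm// => /(_ hd h0).
  by apply: le_lt_trans; exact: ler_norm.
near=> r.
have rt : `|t - r| < d by near: r; exists d.
have rt2 : `|t - r| < t / 2 by near: r; exists (t / 2) => //=; rewrite divr_gt0.
have rt1 : `|t - r| < 1 by near: r; exists 1 => //=.
move: rt rt2 rt1; have [rt|tr|->] := ltgtP r t.
- rewrite gtr0_norm ?subr_gt0// => rtd rt2 rt1.
  apply: half_sqdist_lt => //; apply: le_lt_trans (dP (t - r) _ rtd); last by rewrite subr_gt0.
  by apply: CP => //; lra.
- rewrite ltr0_norm ?subr_lt0// opprB metric_sym => rtd rt2 rt1.
  apply: half_sqdist_lt => //; apply: le_lt_trans (dP (r - t) _ rtd); last by rewrite subr_gt0.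
  by apply: CP => //; lra.
- by rewrite mdistxx.
Unshelve. all: by end_near. Qed.

End metric_curves.

(** * Equivalence of EVI and (IC2), and monotonicity of the energy *)

Section EVI_IC2.
Context {R : realType} {X : metricType R} (phi : X -> \bar R) (lambda : R).
Context (phi_proper : proper_functional phi).
Context (phi_lsc : lower_semicontinuous phi).
Implicit Types (u : R -> X) (v : X) (s t r h e m : R).

Local Notation E := (exp_integral lambda).
Local Notation D := half_sqdist.
Local Notation p v := (fine (phi v)).

Lemma Dom_fineE v : Dom phi v -> phi v = (p v)%:E.
Proof. by move=> vD; rewrite fineK// fin_numE gt_eqF ?lt_eqF//; case: phi_proper. Qed.

(** The EVI in real arithmetic. As [fine] sends $+\infty$ to $0$, the inequality is faithful only
    together with the domain clause. *)
Definition real_EVI u := [/\ forall t, 0 < t -> Dom phi (u t),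
  forall t, 0 < t -> u r @[r --> t] --> u t &
  forall t v e, 0 < t -> Dom phi v -> 0 < e -> \forall h \near 0^'+,
    D u v (t + h) - D u v t <= h * (p v - p (u t) - lambda * D u v t + e)].

Lemma real_EVIP u : is_EVI_solution phi lambda u <-> real_EVI u.
Proof.
have ineqE t v : Dom phi (u t) -> Dom phi v ->
    ((2^-1%:E * dini_ur (fun r => mdist (u r) v ^+ 2)%R t
          + (lambda / 2 * mdist (u t) v ^+ 2)%:E
        <= phi v - phi (u t))%E <->
    forall e, 0 < e -> \forall h \near 0^'+,
    D u v (t + h) - D u v t <= h * (p v - p (u t) - lambda * D u v t + e)).
  move=> utD vD; rewrite (Dom_fineE v)// (Dom_fineE (u t))// -EFinB -mulrA.
  exact: half_dini_ur_leP.
split=> [[uD cu evi]|[uD cu evi]]; split => //.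
- move=> t t0.
  have := cu; rewrite continuous_open_subspace; last exact: interval_open.
  by apply; rewrite inE/= in_itv/= t0.
- by move=> t v e t0 vD e0; apply: (proj1 (ineqE t v (uD _ t0) vD)) => //; exact: evi.
- rewrite continuous_open_subspace; last exact: interval_open.
  by move=> t; rewrite inE/= in_itv/= andbT => /cu.
- by move=> t v t0 vD; apply/ineqE => //; [exact: uD | move=> e e0; exact: evi].
Qed.

(** Finiteness of the energy, which (IC2) implies without stating it, becomes a separate clause
    because [fine] would hide an infinite value. *)
Definition real_IC2 u := (forall t, 0 < t -> Dom phi (u t)) /\
  forall s t v, 0 < s -> s < t -> Dom phi v ->
    expR (lambda * (t - s)) * D u v t - D u v s <= E (t - s) * (p v - p (u t)).

Lemma real_IC2P u : IC2 phi lambda u <-> real_IC2 u.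
Proof.
have ineqE s t v : 0 < s -> s < t -> Dom phi (u t) -> Dom phi v ->
    ((expR (lambda * (t - s)) / 2 * mdist (u t) v ^+ 2
       - 2^-1 * mdist (u s) v ^+ 2)%:E
    <= (E_lambda lambda (t - s))%:E * (phi v - phi (u t)))%E =
    (expR (lambda * (t - s)) * D u v t - D u v s <= E (t - s) * (p v - p (u t))).
  move=> s0 st utD vD; rewrite (Dom_fineE v)// (Dom_fineE (u t))// -EFinB -EFinM.
  by rewrite lee_fin E_lambdaE ?subr_ge0 ?(ltW st)// /half_sqdist -mulrA.
split=> [ic2|[uD ic2] s t v s0 st vD]; last first.
  by rewrite ineqE//; [exact: ic2 | apply: uD; exact: lt_trans st].
have uD t : 0 < t -> Dom phi (u t).
  move=> t0; have [v0 v0D] := phi_proper.2.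
  have t20 : 0 < t / 2 by rewrite divr_gt0.
  have t2t : t / 2 < t by rewrite ltr_pdivrMr// ltr_pMr// ltr1n.
  rewrite /Dom/= ltNge leye_eq; apply/negP => /eqP uty.
  have := ic2 _ _ _ t20 t2t v0D; rewrite uty (Dom_fineE v0)//= mulrNy.
  by rewrite E_lambdaE ?subr_ge0 ?(ltW t2t)// gtr0_sg ?exp_integral_gt0 ?subr_gt0// mul1e leeNy_eq.
split=> // s t v s0 st vD; rewrite -ineqE//; first exact: ic2.
by apply: uD; exact: lt_trans st.
Qed.

Lemma lsc_along u t e : u r @[r --> t] --> u t -> Dom phi (u t) -> 0 < e ->
  \forall r \near t, ((p (u t) - e)%:E < phi (u r))%E.
Proof.
move=> /cvg_mdistP cu utD e0.
have [d d0 dP] : exists2 d, 0 < d &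
    forall y, mdist (u t) y < d -> ((p (u t) - e)%:E < phi y)%E.
  apply: lower_semicontinuous_mdist => //.
  by rewrite [X in (_ < X)%E]Dom_fineE// lte_fin ltrBlDr ltrDl.
by apply: filterS (cu _ d0) => r; exact: dP.
Qed.

(** By the EVI and the lower bound [m] on the energy, $e^{\lambda(r-s)}D_v(r)-\mathsf
    E_\lambda(r-s)(\phi(v)-m)$ has nonpositive upper right derivative. With $v=u_s$ and
    $m=\phi(u_s)$ this is the Gronwall argument for monotonicity; with $m=\phi(u_t)$ it is (IC2). *)
Lemma EVI_bound u s t v m : real_EVI u -> 0 < s -> s <= t -> Dom phi v ->
  (forall r, s <= r <= t -> m <= p (u r)) ->
  expR (lambda * (t - s)) * D u v t - D u v s <= E (t - s) * (p v - m).
Proof.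
move=> [uD cu evi] s0 st vD mp; set c := p v - m.
pose G r := expR (lambda * (r - s)) * D u v r - E (r - s) * c.
have cD r : 0 < r -> D u v x @[x --> r] --> D u v r.
  by move=> r0; exact: cvg_half_sqdist (cu _ r0).
suff : G t <= G s.
  by rewrite /G subrr mulr0 expR0 exp_integral0 mul1r mul0r subr0; lra.
have wE h : expR (lambda * h) = 1 + lambda * E h.
  by rewrite exp_integralM addrC subrK.
apply: nonincreasing_of_dini => // r e /andP[sr rt] e0.
- have r0 : 0 < r by exact: lt_trans sr.
  have cG : G x @[x --> r] --> G r.
    have cE : E (x - s) @[x --> r] --> E (r - s).
      have cB : x - s @[x --> r] --> r - s by apply: cvgB; [exact: cvg_id | exact: cvg_cst].
      apply: (continuous_cvg _ _ cB); apply: differentiable_continuous.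
      by apply/derivable1_diffP; case: (is_derive_exp_integral lambda (r - s)).
    rewrite /G wE; under eq_fun do rewrite wE.
    apply: cvgB; last by apply: cvgM cE _; exact: cvg_cst.
    apply: cvgM; last exact: cD.
    by apply: cvgD; [exact: cvg_cst | exact: cvgMr].
  have /cvgrPdist_le/(_ _ e0) := cvg_at_left_filter cG.
  by apply: filterS => x /ler_normlP[_]; lra.
- have r0 : 0 < r by exact: lt_le_trans sr.
  set w := expR (lambda * (r - s)); have w0 : 0 < w by exact: expR_gt0.
  (* Two errors of size [n], one from the EVI and one from the limit of $\mathsf E_\lambda(h)/h$,
     are multiplied by [w] and add up to [e]. *)
  pose n := e / (2 * w); have n0 : 0 < n by rewrite divr_gt0 ?mulr_gt0.
  have cDh : D u v (r + h) @[h --> 0^'+] --> D u v r.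
    exact: cvg_shift_right (cD _ r0).
  (* The increment $G(r+h)-G(r)$ equals $w$ times $D_v(r+h)-D_v(r)+\mathsf E_\lambda(h)(\lambda
     D_v(r+h)-c)$; this is the limit of the second term divided by $h$. *)
  have cEh : E h / h * (lambda * D u v (r + h) - c) @[h --> 0^'+] -->
      1 * (lambda * D u v r - c).
    apply: cvgM; first exact: cvg_exp_integral_slope.
    by apply: cvgB; [exact: cvgMr | exact: cvg_cst].
  near=> h.
  have h0 : 0 < h by near: h; exact: nbhs_right_gt.
  have Dh : D u v (r + h) - D u v r <= h * (p v - p (u r) - lambda * D u v r + n).
    by near: h; exact: evi.
  have : E h / h * (lambda * D u v (r + h) - c) <= 1 * (lambda * D u v r - c) + n.
    near: h; move/cvgrPdist_le : cEh => /(_ _ n0).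
    by apply: filterS => x /ler_normlP[+ _]; lra.
  rewrite mul1r mulrAC ler_pdivrMr// => Eh.
  have mr : m <= p (u r) by apply: mp; rewrite sr ltW.
  have -> : G (r + h) = w * ((1 + lambda * E h) * D u v (r + h)) - (E (r - s) + w * E h) * c.
    rewrite /G (_ : r + h - s = r - s + h); last by ring.
    by rewrite exp_integralD mulrDr expRD -/w [expR (lambda * h)]wE mulrA.
  rewrite /G -/w.
  have -> : e * h = w * (h * (2 * n)).
    by rewrite /n; field; rewrite gt_eqF.
  have H : D u v (r + h) - D u v r + E h * (lambda * D u v (r + h) - c) <= h * (2 * n).
    have : 0 <= h * (p (u r) - m) by rewrite mulr_ge0 ?(ltW h0)// subr_ge0.
    by move: Dh Eh; rewrite /c; lra.
  by move: H; rewrite -(ler_pM2l w0); lra.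
Unshelve. all: by end_near. Qed.

Lemma EVI_nonincreasing u s t : real_EVI u -> 0 < s -> s <= t ->
  p (u t) <= p (u s).
Proof.
move=> evi s0 st; have [uD cu _] := evi.
have [r /andP[sr rt] clP|m [/andP[sm mt] Pm nP]] :=
    last_point (fun r => p (u r) <= p (u s)) s t st (lexx _).
  have r0 : 0 < r by exact: lt_trans sr.
  apply/ler_addgt0Pr => e e0; rewrite -lerBlDr.
  have [d /= d0 dP] := lsc_along u r e (cu _ r0) (uD _ r0) e0.
  have [x /andP[sx xr] [rdx px]] := clP _ d0.
  apply: le_trans px; have x0 : 0 < x by exact: lt_le_trans sx.
  have := dP x; rewrite /ball_/= gtr0_norm ?subr_gt0// ltrBlDr -ltrBlDl.
  move=> /(_ _)/ltW; rewrite (Dom_fineE (u x)) ?lee_fin; last exact: uD.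
  by apply; lra.
have m0 : 0 < m by exact: lt_le_trans sm.
have [<-//|mNt] := eqVneq m t.
have {}mt : m < t by rewrite lt_neqAle mNt.
exfalso; apply: (nP t); rewrite ?mt ?lexx//.
(* The energy is at least $\phi(u_m)$ on all of $[m,t]$, so [EVI_bound] with $v=u_m$ reaches $t$ in
   one step. *)
suff -> : u t = u m by [].
apply: half_sqdist_le0.
have mp r : m <= r <= t -> p (u m) <= p (u r).
  move=> /andP[]; rewrite le_eqVlt => /predU1P[->//|mr] rt.
  by have /negP := nP r ltac:(by rewrite mr); rewrite -ltNge => /ltW; exact: le_trans.
have := EVI_bound u m t (u m) (p (u m)) evi m0 (ltW mt) (uD _ m0) mp.
by rewrite half_sqdistxx subr0 subrr mulr0 pmulr_rle0// expR_gt0.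
Qed.

Lemma EVI_IC2 u : real_EVI u -> real_IC2 u.
Proof.
move=> evi; have [uD _ _] := evi; split=> // s t v s0 st vD.
apply: EVI_bound => // [|r /andP[sr rt]]; first exact: ltW.
by apply: EVI_nonincreasing => //; exact: lt_le_trans sr.
Qed.

(** Monotonicity bounds $\phi(u_r)$ above by $\phi(u_t)$ for $r>t$; lower semicontinuity along the
    continuous curve bounds it below. *)
Lemma EVI_right_continuous u t : real_EVI u -> 0 < t ->
  phi (u r) @[r --> t^'+] --> phi (u t).
Proof.
move=> evi t0; have [uD cu _] := evi; rewrite (Dom_fineE (u t)); last exact: uD.
apply/fine_cvgP; split.
  near=> r; rewrite Dom_fineE//; apply: uD.
  by apply: lt_trans t0 _; near: r; exact: nbhs_right_gt.
apply/cvgrPdist_le => e e0; near=> r.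
have tr : t < r by near: r; exact: nbhs_right_gt.
have := EVI_nonincreasing u t r evi t0 (ltW tr).
have : ((p (u t) - e)%:E < phi (u r))%E.
  by near: r; apply: cvg_within; exact: lsc_along (cu _ t0) (uD _ t0) e0.
rewrite (Dom_fineE (u r) (uD _ (lt_trans t0 tr))) lte_fin /=.
by rewrite ler_norml; lra.
Unshelve. all: by end_near. Qed.

Lemma IC2_nonincreasing u s t : real_IC2 u -> 0 < s -> s < t ->
  p (u t) <= p (u s).
Proof.
move=> [uD ic2] s0 st; have := ic2 s t (u s) s0 st (uD _ s0).
rewrite half_sqdistxx subr0 => H.
have : 0 <= E (t - s) * (p (u s) - p (u t)).
  by apply: le_trans H; rewrite mulr_ge0 ?half_sqdist_ge0// expR_ge0.
by rewrite pmulr_rge0 ?subr_ge0// exp_integral_gt0// subr_gt0.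
Qed.

(** Testing with $v=u_s$ and bounding the energy drop by monotonicity gives continuity. The EVI then
    follows from (IC2) on $[t,t+h]$ as $h$ decreases to $0$, with $\phi(u_{t+h})$ bounded below by
    lower semicontinuity. *)
Lemma IC2_EVI u : real_IC2 u -> real_EVI u.
Proof.
move=> ic; have [uD ic2] := ic.
have cu t : 0 < t -> u r @[r --> t] --> u t.
  apply: (continuous_of_modulus u E (cvg_exp_integral0 lambda)) => a b a0 ab.
  (* The exponential dominates $e^{-\lambda(t'-s')}$, and the second factor dominates the energy
     drop on $[s',t']$. *)
  exists (expR (`|lambda| * (b - a)) * (p (u a) - p (u b))) => s' t' as' st' tb'.
  have s'0 : 0 < s' by exact: lt_le_trans as'.
  have E0 : 0 < E (t' - s') by rewrite exp_integral_gt0// subr_gt0.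
  have pa : p (u s') <= p (u a).
    by move: as'; rewrite le_eqVlt => /predU1P[<-//|as'];exact: IC2_nonincreasing.
  have pb : p (u b) <= p (u t').
    by move: tb'; rewrite le_eqVlt => /predU1P[<-//|tb']; apply: IC2_nonincreasing => //; exact: lt_trans st'.
  have := ic2 s' t' (u s') s'0 st' (uD _ s'0); rewrite half_sqdistxx subr0 => H.
  have H1 : E (t' - s') * (p (u s') - p (u t')) <= E (t' - s') * (p (u a) - p (u b)).
    by rewrite ler_pM2l//; lra.
  rewrite -mulrA [_ * E _]mulrC -ler_pdivrMl ?expR_gt0// -expRN.
  apply: le_trans (le_trans H H1).
  rewrite ler_wpM2r ?half_sqdist_ge0// ler_expR.
  have : - (`|lambda| * (t' - s')) <= lambda * (t' - s').
    rewrite -mulNr ler_wpM2r ?subr_ge0 ?(ltW st')//.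
    by rewrite lerNl -normrN ler_norm.
  apply: le_trans; rewrite lerN2 ler_wpM2l//; lra.
split=> // t v e t0 vD e0; set B := p v - p (u t) - lambda * D u v t.
(* One third each for the energy at $t+h$, for $\lambda D_v(t+h)$, and for replacing $\mathsf
   E_\lambda(h)/h$ by $1$. *)
pose n := e / 3; have n0 : 0 < n by rewrite divr_gt0.
have cEh : E h / h * (B + 2 * n) @[h --> 0^'+] --> 1 * (B + 2 * n).
  by apply: cvgM; [exact: cvg_exp_integral_slope | exact: cvg_cst].
have cDh : lambda * D u v (t + h) @[h --> 0^'+] --> lambda * D u v t.
  by apply: cvgMr; apply: cvg_shift_right; exact: cvg_half_sqdist (cu _ t0).
near=> h.
have h0 : 0 < h by near: h; exact: nbhs_right_gt.
have th0 : 0 < t + h by rewrite addr_gt0.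
have : E h / h * (B + 2 * n) <= 1 * (B + 2 * n) + n.
  near: h; move/cvgrPdist_le : cEh => /(_ _ n0).
  by apply: filterS => x /ler_normlP[+ _]; lra.
rewrite mul1r mulrAC ler_pdivrMr// => Eh.
have lD : lambda * D u v t - n <= lambda * D u v (t + h).
  near: h; move/cvgrPdist_le : cDh => /(_ _ n0).
  by apply: filterS => x /ler_normlP[_ +]; lra.
have : ((p (u t) - n)%:E < phi (u (t + h)%R))%E.
  by near: h; exact: (near_shift_right _ _ (lsc_along u t n (cu _ t0) (uD _ t0) n0)).
rewrite (Dom_fineE (u (t + h)) (uD _ th0)) lte_fin /=.
move=> ph; have := ic2 t (t + h) v t0 _ vD; rewrite ltrDl => /(_ h0).
rewrite (addrC t h) addrK (addrC h t) (_ : expR _ = 1 + lambda * E h); last first.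
  by rewrite exp_integralM addrC subrK.
move=> ic2h.
have E0 : 0 < E h by exact: exp_integral_gt0.
have : E h * (p v - p (u (t + h)) - lambda * D u v (t + h)) <= E h * (B + 2 * n).
  by rewrite ler_pM2l// /B; lra.
have -> : h * (B + e) = h * (B + 3 * n) by rewrite /n; field.
by move: ic2h Eh; lra.
Unshelve. all: by end_near. Qed.

End EVI_IC2.

(** * EVI and (IC1) *)

Section EVI_to_IC1.
Context {R : realType} {X : metricType R} (phi : X -> \bar R) (lambda : R).
Context (phi_proper : proper_functional phi).
Context (phi_lsc : lower_semicontinuous phi).
Implicit Types (u : R -> X) (v : X) (s t r h e m a b : R).
Local Notation cmu := (@completed_lebesgue_measure R).
Local Notation D := half_sqdist.
Local Notation p v := (fine (phi v)).

(** Integrability holds because the energy is monotone and the distance continuous. For the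
    inequality, [nonincreasing_of_dini] needs only upper bounds on increments of the integral, and
    on $[r,r+h]$ the energy is at most $\phi(u_r)$. *)
Lemma EVI_IC1 u : real_EVI phi lambda u -> IC1 phi lambda u.
Proof.
move=> evi v vD; have [uD cu eviu] := evi.
have cD t : 0 < t -> {for t, continuous (D u v)}.
  by move=> t0; exact: cvg_half_sqdist (cu _ t0).
have Fni a b : 0 < a -> a <= b -> p (u b) <= p (u a).
  by move=> a0 ab; apply: EVI_nonincreasing evi a0 ab.
have mF a b : 0 < a -> measurable_fun `[a, b] (fun x => p (u x)).
  move=> a0; apply: measurable_nonincreasing_pos => x y ax; apply: Fni.
  exact: lt_le_trans ax.
have bF a b : 0 < a -> exists c, forall x, a <= x <= b -> `|p (u x)| <= c.
  move=> a0; exists (`|p (u a)| + `|p (u b)|) => x /andP[ax xb].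
  have xa := Fni a x a0 ax; have bx := Fni x b (lt_le_trans a0 ax) xb.
  have := ler_norm (p (u a)); have := ler_norm (- p (u b)); rewrite normrN.
  have := normr_ge0 (p (u a)); have := normr_ge0 (p (u b)).
  by rewrite ler_norml; lra.
have mD a b : 0 < a -> measurable_fun `[a, b] (D u v).
  move=> a0; apply: measurable_continuous_itv => x /andP[ax _]; apply: cD.
  exact: lt_le_trans ax.
have bD a b : 0 < a -> exists c, forall x, a <= x <= b -> `|D u v x| <= c.
  move=> a0; apply: bounded_continuous_itv => x /andP[ax _]; apply: cD.
  exact: lt_le_trans ax.
pose f r := p (u r) + lambda * D u v r.
have mf a b : 0 < a -> measurable_fun `[a, b] f.
  by move=> a0; apply: measurable_funD (mF _ _ a0) _; apply: measurable_funM => //; exact: mD.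
have bf a b : 0 < a -> exists c, forall x, a <= x <= b -> `|f x| <= c.
  move=> a0; have [c1 F1] := bF a b a0; have [c2 D2] := bD a b a0.
  exists (c1 + `|lambda| * c2) => x xab; apply: le_trans (ler_normD _ _) _.
  by rewrite lerD ?F1// normrM ler_wpM2l// D2.
split.
- exact: (L1loc_pos _ (fun r => p (u r)) (fun x x0 => Dom_fineE phi phi_proper _ (uD x x0))).
- apply: (L1loc_pos _ (fun r => 2 * D u v r)).
  + by move=> x x0; rewrite /half_sqdist mulrA divff// mul1r.
  + by move=> a b a0; apply: measurable_funM => //; exact: mD.
  + move=> a b a0; have [c Dc] := bD a b a0; exists (2 * c) => x xab.
    by rewrite normrM ger0_norm// ler_pM2l// Dc.
move=> s t s0 st.
(* The boolean selects a closed or open left end; open ones occur when the integral is split at an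
   interior time. *)
have intf a (b : bool) b' : 0 < a -> a <= b' ->
    cmu.-integrable [set` Interval (BSide b a) (BRight b')] (EFin \o f).
  move=> a0 ab'; have [c fc] := bf a b' a0.
  apply: (integrableS (measurable_itv_completed `[a, b'])).
  - exact: measurable_itv_completed.
  - by case: b => // x /=; rewrite !in_itv/= => /andP[/ltW-> ->].
  - apply: (completed_integrable_bounded _ _ c).
    + exact: segment_compact.
    + by apply: measurable_fun_completed => //; exact: mf.
    + by move=> x; rewrite /= in_itv/=; exact: fc.
pose J r := \int[cmu]_(x in `[s, r]) f x.
have JE a b c : s <= a -> a <= b -> (forall x, a <= x <= b -> f x <= c) ->
    J b <= J a + c * (b - a).
  move=> sa ab fc; have sb := le_trans sa ab; have a0 := lt_le_trans s0 sa.
  rewrite /J (@itv_bndbnd_setU _ _ _ (BRight a)) ?bnd_simp//.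
  rewrite Rintegral_setU; last 4 first.
  - exact: measurable_itv_completed.
  - exact: measurable_itv_completed.
  - by rewrite -itv_bndbnd_setU ?bnd_simp//; exact: intf.
  - by apply/disj_setPLR => x /=; rewrite !in_itv/= => /andP[_ xa] /andP[ax _]; move: xa; rewrite leNgt ax.
  have iab := intf a false b a0 ab.
  rewrite lerD2l -lee_fin /Rintegral fineK; last first.
    by apply: integrable_fin_num iab; exact: measurable_itv_completed.
  by apply: completed_integral_le => // x xab; rewrite lee_fin; exact: fc.
(* The integral over a single point lies between $-c\cdot0$ and $c\cdot0$. *)
have Js : J s = 0.
  rewrite /J /Rintegral; have is_ := intf s true s s0 (lexx _).
  have [c fc] := bf s s s0.
  have H1 := completed_integral_le true s s c (EFin \o f) (lexx _) is_.
  have H2 := completed_integral_ge true s s (- c) (EFin \o f) (lexx _) is_.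
  suff -> : (\int[cmu]_(x in `[s, s]) (f x)%:E = 0)%E by [].
  apply/eqP; rewrite eq_le; apply/andP; split.
    rewrite -[X in (_ <= X)%E](_ : (c * (s - s))%:E = _); last by rewrite subrr mulr0.
    by apply: H1 => x /fc; rewrite lee_fin; apply: le_trans; exact: ler_norm.
  rewrite -[X in (X <= _)%E](_ : (- c * (s - s))%:E = _); last by rewrite subrr mulr0.
  by apply: H2 => x /fc; rewrite lee_fin ler_norml => /andP[].
pose G r := D u v r + J r - r * p v.
suff GG : G t <= G s.
  have -> : (\int[cmu]_(r in `[s, t]) (phi (u r) + (lambda / 2 * mdist (u r) v ^+ 2)%:E) =
      (J t)%:E)%E.
    rewrite /J /Rintegral fineK; last first.
      by apply: integrable_fin_num (intf s true t s0 (ltW st)); exact: measurable_itv_completed.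
    apply: eq_integral => x; rewrite inE/= in_itv/= => /andP[sx _].
    rewrite (Dom_fineE phi phi_proper (u x)); last by apply: uD; exact: lt_le_trans sx.
    by rewrite -EFinD /f /half_sqdist/= -mulrA.
  rewrite (Dom_fineE phi phi_proper v)// -EFinD -EFinM lee_fin.
  by move: GG; rewrite /G Js /half_sqdist; lra.
apply: nonincreasing_of_dini (ltW st) _ _ => r e /andP[sr rt] e0.
- have r0 : 0 < r by exact: lt_trans sr.
  have [c fc] := bf s r s0.
  (* A positive bound for $c-\phi(v)$: within $n/c'$ of $r$, the integral and the linear term
     together change [G] by at most [n] upwards, and continuity of $D_v$ accounts for the other
     [n]. *)
  pose c' := `|c| + `|p v| + 1; have c'0 : 0 < c' by rewrite ltr_wpDl// addr_ge0.
  pose n := e / 2; have n0 : 0 < n by rewrite divr_gt0.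
  have nc0 : 0 < n / c' by rewrite divr_gt0.
  near=> x.
  have xr : x < r by near: x; exact: nbhs_left_lt.
  have sx : s <= x by near: x; exact: nbhs_left_ge.
  have : r - n / c' <= x by near: x; apply: nbhs_left_ge; rewrite ltrBlDr ltrDl.
  rewrite lerBlDr -lerBlDl ler_pdivlMr// => xc.
  have : `|D u v r - D u v x| <= n.
    near: x; have /cvg_at_left_filter/cvgrPdist_le := cD _ r0; exact.
  rewrite ler_norml => /andP[_ Dx].
  have := JE x r c sx (ltW xr) (fun y yr => le_trans (ler_norm _) (fc y ltac:(by case/andP: yr => xy ->; rewrite (le_trans sx)))).
  have : (r - x) * (c - p v) <= (r - x) * c'.
    rewrite ler_pM2l ?subr_gt0// /c'.
    by have := ler_norm c; have := ler_norm (- p v); rewrite normrN; lra.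
  by move: xc; rewrite /G {1}(_ : e = n + n); [lra | rewrite /n; lra].
- have r0 : 0 < r by exact: lt_le_trans sr.
  pose n := e / 2; have n0 : 0 < n by rewrite divr_gt0.
  have /cvgrPdist_le/(_ _ n0)[d /= d0 dP] : lambda * D u v x @[x --> r] --> lambda * D u v r.
    by apply: cvgMr; exact: cD.
  near=> h.
  have h0 : 0 < h by near: h; exact: nbhs_right_gt.
  have hd : h < d by near: h; exact: nbhs_right_lt.
  have Dh : D u v (r + h) - D u v r <= h * (p v - p (u r) - lambda * D u v r + n).
    by near: h; exact: eviu.
  have := JE r (r + h) (p (u r) + lambda * D u v r + n) sr.
  rewrite lerDl (ltW h0) => /(_ isT) Jh.
  have {}Jh : J (r + h) <= J r + (p (u r) + lambda * D u v r + n) * (r + h - r).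
    apply: Jh => x /andP[rx xh]; rewrite /f -addrA lerD ?Fni//.
    have : `|r - x| < d by rewrite distrC ger0_norm ?subr_ge0//; lra.
    by move=> /dP /ler_normlP[+ _]; lra.
  by move: Jh Dh; rewrite /G (_ : e = n + n); [lra | rewrite /n; lra].
Unshelve. all: by end_near. Qed.

End EVI_to_IC1.

(** * From (IC1) to EVI, with no continuity assumed *)

Section IC1_to_EVI.
Context {R : realType} {X : metricType R} (phi : X -> \bar R) (lambda : R).
Context (phi_proper : proper_functional phi).
Context (phi_lsc : lower_semicontinuous phi).
Context (u : R -> X) (ic : IC1 phi lambda u).
Implicit Types (v : X) (s t r h e m a b c C M : R).
Local Notation cmu := (@completed_lebesgue_measure R).
Local Notation completedR := (caratheodory_type (wlength (@idfun R))^*%mu).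
Local Notation D := half_sqdist.
Local Notation p v := (fine (phi v)).

Lemma IC1_integrable_phi a b : 0 < a ->
  cmu.-integrable `[a, b] (fun r => phi (u r)).
Proof.
by move=> a0; have [v0 /ic[+ _ _]] := phi_proper.2; move/L1loc_itv; exact.
Qed.

Lemma IC1_integrable v a b : Dom phi v -> 0 < a ->
  cmu.-integrable `[a, b]
    (fun r => phi (u r) + (lambda / 2 * mdist (u r) v ^+ 2)%:E)%E.
Proof.
move=> vD a0; have [_ H _] := ic _ vD.
have mab := measurable_itv_completed `[a, b].
apply: integrableD => //; first exact: IC1_integrable_phi.
exact: (integrableZl mab (lambda / 2) (L1loc_itv _ a b H a0)).
Qed.

(** The term $-\lambda D_v$ in the lower bound cancels the one in the integrand, which is then at
    least [c]. Monotonicity, continuity and the EVI itself are all drawn from this estimate. *)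
Lemma IC1_ge v s t c : Dom phi v -> 0 < s -> s < t ->
  (forall r, s <= r <= t -> ((c - lambda * D u v r)%:E <= phi (u r))%E) ->
  D u v t - D u v s <= (t - s) * (p v - c).
Proof.
move=> vD s0 st cphi; have [_ _ /(_ s t s0 st)] := ic _ vD.
have : ((c * (t - s))%:E <= \int[cmu]_(r in `[s, t])
    (phi (u r) + (lambda / 2 * mdist (u r) v ^+ 2)%:E))%E.
  apply: completed_integral_ge; [exact: ltW | exact: IC1_integrable |].
  move=> r /cphi; rewrite -leeBlDr// -EFinB.
  by rewrite /half_sqdist mulrA.
rewrite (Dom_fineE phi phi_proper v)// => cI H.
have : ((2^-1 * mdist (u t) v ^+ 2 - 2^-1 * mdist (u s) v ^+ 2)%:E
   + (c * (t - s))%:E <= (t - s)%:E * (p v)%:E)%E.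
  by apply: le_trans H; exact: leeD2l.
by rewrite -EFinD -EFinM lee_fin /half_sqdist; lra.
Qed.

(** The inequality started at [a] bounds $D_v(r)$ by $D_v(a)$, the linear term, and the absolute
    value of an integral over $[a,r]$, itself at most the integral of the absolute value over
    $[a,b]$. *)
Lemma IC1_bounded v a b : Dom phi v -> 0 < a ->
  exists2 M, 0 <= M & forall r, a <= r <= b -> D u v r <= M.
Proof.
move=> vD a0; pose f r := (phi (u r) + (lambda / 2 * mdist (u r) v ^+ 2)%:E)%E.
have mab := measurable_itv_completed `[a, b].
have intab : cmu.-integrable `[a, b] f by exact: IC1_integrable.
have Ifin := integrable_fin_num mab (integrable_abse intab).
pose I := fine (\int[cmu]_(r in `[a, b]) `|f r|)%E.
have I0 : 0 <= I by apply: fine_ge0; exact: integral_ge0.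
have Da0 := half_sqdist_ge0 u v a.
exists (D u v a + `|b - a| * `|p v| + I).
  by rewrite !addr_ge0// mulr_ge0.
move=> r /andP[]; rewrite le_eqVlt => /predU1P[<- _|ar rb].
  by rewrite -addrA lerDl addr_ge0// mulr_ge0.
have [_ _ /(_ a r a0 ar)] := ic _ vD; rewrite -/(f _).
have intar : cmu.-integrable `[a, r] f by exact: IC1_integrable.
have mar := measurable_itv_completed `[a, r].
have : (`|\int[cmu]_(x in `[a, r]) f x| <= I%:E)%E.
  have mf : measurable_fun (`[a, b] : set completedR) (abse \o f).
    exact: measurableT_comp (@abse_measurable R setT) (measurable_int cmu intab).
  have f0 x : `[a, b]%classic x -> (0 <= (abse \o f) x)%E by move=> _; exact: abse_ge0.
  have arb : `[a, r] `<=` `[a, b].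
    by move=> x /=; rewrite !in_itv/= => /andP[-> xr]; rewrite (le_trans xr).
  rewrite fineK//; apply: le_trans (ge0_subset_integral cmu mar mab mf f0 arb).
  by apply: le_abse_integral => //; exact: (measurable_int cmu intar).
have := integrable_fin_num mar intar.
rewrite (Dom_fineE phi phi_proper v)//.
rewrite -[X in (_ + X <= _)%E]/(\int[cmu]_(x in `[a, r]) f x)%E.
case: (\int[cmu]_(x in `[a, r]) f x)%E => // z _.
rewrite -EFinD -EFinM !lee_fin -!/(half_sqdist u v _) => zI H.
have : (r - a) * p v <= `|b - a| * `|p v|.
  apply: le_trans (ler_norm _) _; rewrite normrM ler_wpM2r//.
  have ra0 : 0 <= r - a by rewrite subr_ge0 ltW.
  have rb0 : r - a <= b - a by rewrite lerD2r.
  by rewrite (ger0_norm ra0) (ger0_norm (le_trans ra0 rb0)).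
by have := ler_norm (- z); rewrite normrN; move: I zI H {I0 Ifin} => I; lra.
Qed.

Lemma IC1_diameter a b : 0 < a ->
  exists2 C, 0 <= C & forall r s, a <= r <= b -> a <= s <= b ->
    D u (u s) r <= C.
Proof.
move=> a0; have [v0 v0D] := phi_proper.2.
have [M M0 DM] := IC1_bounded v0 a b v0D a0.
(* From $x\le y+z$ follows $x^2/2\le y^2+z^2$, and $y^2$ and $z^2$ are each at most $2M$. *)
exists (4 * M); first by rewrite mulr_ge0.
move=> r s /DM + /DM; rewrite /half_sqdist.
have := metric_triangle (u r) v0 (u s); rewrite (metric_sym v0).
have := mdist_ge0 (u r) (u s).
move: (mdist (u r) (u s)) (mdist (u r) v0) (mdist (u s) v0) => x y z x0 xyz.
have : x ^+ 2 <= (y + z) ^+ 2 by rewrite ler_pXn2r// nnegrE//; exact: le_trans xyz.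
have := sqr_ge0 (y - z); rewrite !expr2; lra.
Qed.

(** This is (IC1) with $v=u_s$, the distance term of the integrand being bounded below by
    $-|\lambda|C$. Isolating the energy integral allows [completed_integral_absc] to be applied to
    it. *)
Lemma IC1_sqdist_le s t C : 0 < s -> s < t -> Dom phi (u s) -> 0 <= C ->
  (forall r, s <= r <= t -> D u (u s) r <= C) ->
  ((D u (u s) t)%:E + \int[cmu]_(r in `[s, t]) phi (u r)
    <= ((t - s) * (p (u s) + `|lambda| * C))%:E)%E.
Proof.
move=> s0 st usD C0 DC; have [_ _ /(_ s t s0 st)] := ic _ usD.
have mst := measurable_itv_completed `[s, t].
have intC := completed_integrable_cst true s t (- (`|lambda| * C)) (ltW st).
have intphi := IC1_integrable_phi s t s0.
rewrite -!/(half_sqdist u _ _) half_sqdistxx subr0.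
have : (\int[cmu]_(r in `[s, t]) (phi (u r) + cst (- (`|lambda| * C))%:E r) <=
    \int[cmu]_(r in `[s, t])
      (phi (u r) + (lambda / 2 * mdist (u r) (u s) ^+ 2)%:E))%E.
  apply: (le_integral mst (integrableD mst intphi intC) (IC1_integrable (u s) s t usD s0)).
  move=> r; rewrite inE/= in_itv/= => rst; rewrite leeD2l// lee_fin -mulrA.
  rewrite -/(half_sqdist u (u s) r) lerNl.
  apply: le_trans (ler_norm _) _; rewrite normrN normrM ler_wpM2l//.
  by rewrite ger0_norm ?half_sqdist_ge0// DC.
rewrite integralD// completed_integral_cst ?(ltW st)//.
have := integrable_fin_num mst intphi.
case: (\int[cmu]_(r in `[s, t]) phi (u r))%E => // z _.
rewrite -EFinD => zI; rewrite (Dom_fineE phi phi_proper (u s) usD) => H.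
have : ((D u (u s) t)%:E + (z + - (`|lambda| * C) * (t - s))%:E
    <= (t - s)%:E * (p (u s))%:E)%E by apply: le_trans H; exact: leeD2l.
by rewrite -EFinM -!EFinD !lee_fin; lra.
Qed.

(* As [u] is not yet known to be continuous, the Gronwall argument runs on the
   supremum of [D u (u m)] over a short interval, finite by [IC1_diameter]. *)
Lemma IC1_nonincreasing s t : 0 < s -> s <= t -> Dom phi (u s) ->
  (phi (u t) <= phi (u s))%E.
Proof.
move=> s0 st usD.
have [C C0 DC] := IC1_diameter s t s0.
have phiNy x : (-oo < phi (u x))%E by exact: phi_proper.1.
have [r /andP[sr rt] clP|m [/andP[sm mt] Pm nP]] :=
    last_point (fun r => (phi (u r) <= phi (u s))%E) s t st (lexx _).
  rewrite leNgt; apply/negP; rewrite [X in (X < _)%E](Dom_fineE phi phi_proper)// => sphi.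
  have [d d0 dP] := lower_semicontinuous_mdist phi _ _ phi_lsc sphi.
  (* The energy integral and the right-hand side of [IC1_sqdist_le] cost at most [e] each, so the
     half squared distance from $u_x$ to $u_r$ is below $2e=d^2/4<d^2/2$. *)
  pose e := d ^+ 2 / 8; have e0 : 0 < e by rewrite divr_gt0// exprn_gt0.
  have [n n0 nP] := completed_integral_absc s r _ e phiNy (IC1_integrable_phi s r s0) e0.
  pose c := `|p (u s)| + `|lambda| * C + 1.
  have c0 : 0 < c by rewrite ltr_wpDl// addr_ge0// mulr_ge0.
  have [|x /andP[sx xr] [rx px]] := clP (Num.min n (e / c)).
    by rewrite lt_min n0 divr_gt0.
  move: rx; rewrite ltrBlDr -ltrBlDl lt_min => /andP[rxn].
  rewrite ltr_pdivlMr// => rxe.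
  have uxD : Dom phi (u x) by exact: le_lt_trans usD.
  have x0 := lt_le_trans s0 sx.
  suff : (phi (u s) < phi (u x))%E by rewrite ltNge px.
  rewrite (Dom_fineE phi phi_proper (u s))//.
  apply: dP; apply: half_sqdist_lt => //.
  have : ((- e)%:E <= \int[cmu]_(y in `[x, r]) phi (u y))%E.
    by apply: nP => //; exact: ltW.
  have xr_st y : x <= y <= r -> D u (u x) y <= C.
    move=> /andP[xy yr]; apply: DC; rewrite ?sx ?(le_trans sx xy) ?(le_trans yr rt)//.
    by rewrite (le_trans (ltW xr)).
  have pxs : p (u x) <= p (u s).
    by move: px; rewrite (Dom_fineE phi phi_proper (u x) uxD) (Dom_fineE phi phi_proper (u s) usD) lee_fin.
  have := IC1_sqdist_le x r C x0 xr uxD C0 xr_st.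
  have := integrable_fin_num (measurable_itv_completed `[x, r]) (IC1_integrable_phi x r x0).
  case: (\int[cmu]_(y in `[x, r]) phi (u y))%E => // z _.
  rewrite -EFinD !lee_fin => H ez.
  have : (r - x) * (p (u x) + `|lambda| * C) <= (r - x) * c.
    by rewrite ler_pM2l ?subr_gt0// /c; have := ler_norm (p (u s)); lra.
  have : 0 < d ^+ 2 by rewrite exprn_gt0.
  by move: rxe H ez; rewrite /e; lra.
have m0 : 0 < m by exact: lt_le_trans sm.
have [<-//|mNt] := eqVneq m t.
have {mNt}mt' : m < t by rewrite lt_neqAle mNt.
have umD : Dom phi (u m) by exact: le_lt_trans usD.
(* Short enough to stay in $[m,t]$ and to give $|\lambda|n\le1/2$. *)
pose n := Num.min (t - m) (2 * (`|lambda| + 1))^-1.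
have n0 : 0 < n by rewrite lt_min subr_gt0 mt' invr_gt0 mulr_gt0// ltr_wpDl.
have nt : m + n <= t by rewrite -lerBrDl ge_min lexx.
have ln : `|lambda| * n <= 2^-1.
  have : n <= (2 * (`|lambda| + 1))^-1 by rewrite ge_min lexx orbT.
  rewrite -div1r ler_pdivlMr ?mulr_gt0 ?ltr_wpDl// => H.
  by have := normr_ge0 lambda; nra.
pose S := [set D u (u m) r | r in `[m, m + n]].
have ubS : ubound S C.
  move=> _ [r + <-]; rewrite /= in_itv/= => /andP[mr rn].
  by apply: DC; rewrite ?sm// (le_trans sm mr) (le_trans rn nt).
have Sm : S (D u (u m) m) by exists m => //; rewrite /= in_itv/= lexx lerDl ltW.
have gS r : m <= r <= m + n -> D u (u m) r <= sup S.
  by move=> rmn; apply: ub_le_sup; [exists C | exists r].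
have S0 : 0 <= sup S.
  by rewrite -(half_sqdistxx u m); apply: gS; rewrite lexx lerDl ltW.
(* After $m$ the energy is at least $\phi(u_m)$, and $|\lambda|D_{u_m}\le|\lambda|\sup S$; so
   [IC1_ge] yields $D_{u_m}(r)\le n|\lambda|\sup S$. *)
have gS2 r : m <= r <= m + n -> D u (u m) r <= sup S / 2.
  move=> /andP[]; rewrite le_eqVlt => /predU1P[<- _|mr rn].
    by rewrite half_sqdistxx divr_ge0.
  have phic y : m <= y <= r ->
      ((p (u m) - `|lambda| * sup S - lambda * D u (u m) y)%:E <= phi (u y))%E.
    move=> /andP[my yr].
    have : ((p (u m))%:E <= phi (u y))%E.
      rewrite -(Dom_fineE phi phi_proper _ umD).
      move: my; rewrite le_eqVlt => /predU1P[->//|my].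
      have yt : m < y <= t by rewrite my (le_trans yr) ?(le_trans rn).
      have /negP := nP y yt; rewrite -ltNge => /ltW; exact: le_trans.
    apply: le_trans; rewrite lee_fin -addrA gerDl -opprD oppr_le0.
    have Dy : D u (u m) y <= sup S by apply: gS; rewrite my (le_trans yr).
    have : - lambda * D u (u m) y <= `|lambda| * sup S.
      apply: le_trans (ler_norm _) _; rewrite normrM normrN ler_wpM2l//.
      by rewrite ger0_norm ?half_sqdist_ge0.
    by lra.
  have := IC1_ge (u m) m r (p (u m) - `|lambda| * sup S) umD m0 mr phic.
  rewrite half_sqdistxx subr0 subKr => /le_trans; apply.
  have rmn : r - m <= n by lra.
  have : (r - m) * (`|lambda| * sup S) <= n * (`|lambda| * sup S).
    by rewrite ler_wpM2r ?mulr_ge0.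
  have : `|lambda| * n * sup S <= 2^-1 * sup S by rewrite ler_wpM2r.
  by lra.
(* Hence $\sup S\le0$, so the curve is still at $u_m$ at time $m+n$, against the choice of $m$. *)
have S2 : sup S <= sup S / 2.
  apply: ge_sup; first by exists (D u (u m) m).
  by move=> _ [r rmn <-]; apply: gS2; move: rmn; rewrite /= in_itv.
have := nP (m + n); rewrite ltrDl n0 nt => /(_ isT); case.
suff -> : u (m + n) = u m by [].
apply: half_sqdist_le0; apply: le_trans (gS (m + n) _) _.
  by rewrite lexx lerDl ltW.
by lra.
Qed.

(** If the energy were infinite on all of $[t/2,t]$, its integral there would exceed every real,
    contrary to local integrability. So it is finite at some $s\le t$, and monotonicity carries this
    to $t$. *)
Lemma IC1_Dom t : 0 < t -> Dom phi (u t).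
Proof.
move=> t0; have t20 : 0 < t / 2 by rewrite divr_gt0.
have tt2 : t / 2 <= t by lra.
suff [s /andP[st2 st] usD] : exists2 s, t / 2 <= s <= t & Dom phi (u s).
  have s0 := lt_le_trans t20 st2.
  exact: le_lt_trans (IC1_nonincreasing s t s0 st usD) usD.
apply: contrapT => nD.
have phiy s c : t / 2 <= s <= t -> (c%:E <= phi (u s))%E.
  move=> st; rewrite leNgt; apply/negP => phic; apply: nD; exists s => //.
  exact: lt_trans phic (ltry _).
have int := IC1_integrable_phi (t / 2) t t20.
have := integrable_fin_num (measurable_itv_completed _) int.
have H c := completed_integral_ge true (t / 2) t c _ tt2 int (fun s => phiy s c).
move: H; case: (\int[cmu]_(y in `[(t / 2)%R, t]) phi (u y))%E => // z H _.
have := H ((z + 1) / (t - t / 2)); rewrite divfK ?lee_fin; first by lra.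
by rewrite gt_eqF//; lra.
Qed.

Lemma IC1_fine_nonincreasing s t : 0 < s -> s <= t -> p (u t) <= p (u s).
Proof.
move=> s0 st; have t0 := lt_le_trans s0 st.
have := IC1_nonincreasing s t s0 st (IC1_Dom s s0).
rewrite (Dom_fineE phi phi_proper _ (IC1_Dom s s0)).
by rewrite (Dom_fineE phi phi_proper _ (IC1_Dom t t0)) lee_fin.
Qed.

(** Two uses of [IC1_ge]: with the energy bounded below by its value at the right end, which gives
    continuity, and then with the bound supplied near $t$ by lower semicontinuity, which gives the
    EVI. *)
Lemma IC1_EVI : real_EVI phi lambda u.
Proof.
have cu t : 0 < t -> u r @[r --> t] --> u t.
  apply: (continuous_of_modulus u id) => [|a b a0 ab].
    exact: cvg_at_right_filter cvg_id.
  have [C C0 DC] := IC1_diameter a b a0.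
  exists (p (u a) - p (u b) + `|lambda| * C) => s' t' as' st' tb'.
  have s'0 := lt_le_trans a0 as'.
  have phic r : s' <= r <= t' ->
      ((p (u b) - `|lambda| * C - lambda * D u (u s') r)%:E <= phi (u r))%E.
    move=> /andP[sr rt].
    have r0 := lt_le_trans s'0 sr.
    have rb := le_trans rt tb'.
    rewrite (Dom_fineE phi phi_proper _ (IC1_Dom r r0)) lee_fin.
    have := IC1_fine_nonincreasing r b r0 rb.
    have Dr : D u (u s') r <= C.
      by apply: DC; rewrite ?as' ?rb ?(le_trans as' sr)// (le_trans (ltW st')).
    have : - lambda * D u (u s') r <= `|lambda| * C.
      apply: le_trans (ler_norm _) _; rewrite normrM normrN ler_wpM2l//.
      by rewrite ger0_norm ?half_sqdist_ge0.
    by lra.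
  have := IC1_ge (u s') s' t' _ (IC1_Dom _ s'0) s'0 st' phic.
  rewrite half_sqdistxx subr0 => /le_trans; apply.
  rewrite mulrC ler_pM2r ?subr_gt0//.
  by have := IC1_fine_nonincreasing a s' a0 as'; lra.
split=> [|//|t v e t0 vD e0]; first exact: IC1_Dom.
pose n := e / 2; have n0 : 0 < n by rewrite divr_gt0.
have : \forall r \near t, ((p (u t) - n)%:E < phi (u r))%E /\
    lambda * D u v t - n <= lambda * D u v r.
  near=> r; split; near: r.
    exact: lsc_along (cu _ t0) (IC1_Dom _ t0) n0.
  have /cvgrPdist_le/(_ _ n0) : lambda * D u v x @[x --> t] --> lambda * D u v t.
    by apply: cvgMr; exact: cvg_half_sqdist (cu _ t0).
  by apply: filterS => x /ler_normlP[_]; lra.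
move=> [d /= d0 dP]; near=> h.
have h0 : 0 < h by near: h; exact: nbhs_right_gt.
have hd : h < d by near: h; exact: nbhs_right_lt.
(* Half of [e] covers the drop of the energy below $\phi(u_t)$, the other half that of $\lambda D_v$
   below its value at $t$. *)
have phic r : t <= r <= t + h ->
    ((p (u t) + lambda * D u v t - e - lambda * D u v r)%:E <= phi (u r))%E.
  move=> /andP[tr rh]; have [|H1 H2] := dP r.
    by rewrite /ball_/= distrC ger0_norm ?subr_ge0//; lra.
  by apply: le_trans (ltW H1); rewrite lee_fin; move: H2; rewrite /n; lra.
have := IC1_ge v t (t + h) _ vD t0 (ltac:(by rewrite ltrDl)) phic.
by rewrite addrAC subrr add0r => /le_trans; apply; rewrite ler_pM2l//; lra.
Unshelve. all: by end_near. Qed.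

End IC1_to_EVI.

(** * The equivalences, monotonicity and right continuity assembled *)

Local Open Scope ereal_scope.

Theorem theorem3p3 (R : realType) (X : metricType R) (phi : X -> \bar R)
    (lambda : R) (phi_proper : proper_functional phi)
    (phi_lsc : lower_semicontinuous phi) (u : R -> X)
    (u_closure : forall t : R, (0 < t)%R -> closure (Dom phi) (u t)) :
  [/\ is_EVI_solution phi lambda u <-> IC1 phi lambda u,
      is_EVI_solution phi lambda u <-> IC2 phi lambda u &
      is_EVI_solution phi lambda u ->
        (forall s t : R, (0 < s)%R -> (s <= t)%R -> phi (u t) <= phi (u s)) /\
        (forall t : R, (0 < t)%R -> phi (u r) @[r --> t^'+] --> phi (u t))].
Proof.
have evi_ic2 : is_EVI_solution phi lambda u <-> IC2 phi lambda u.
  rewrite real_EVIP// real_IC2P//; split; first exact: EVI_IC2.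
  exact: IC2_EVI.
have evi_ic1 : is_EVI_solution phi lambda u <-> IC1 phi lambda u.
  rewrite real_EVIP//; split; first exact: EVI_IC1.
  exact: IC1_EVI.
split=> // /(real_EVIP phi lambda phi_proper) evi; split=> [s t s0 st|t t0].
  have [uD _ _] := evi; have t0 := lt_le_trans s0 st.
  rewrite (Dom_fineE phi phi_proper (u t)); last exact: uD.
  rewrite (Dom_fineE phi phi_proper (u s)); last exact: uD.
  by rewrite lee_fin; apply: EVI_nonincreasing evi s0 st.
exact: EVI_right_continuous evi t0.
Qed.
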